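(* Let $k$ be a commutative ring, let $T$ be a finite lattice, let $(E,R)=\mathrm{Irr}(T)$, let $X$ be a finite set, and let $\mathcal{B}_X$ be the set of all maps $\varphi:X\to T$ such that $E\subseteq\varphi(X)\subseteq G$, where $G=G(T)$. The elements $\Theta_{T,X}(\varphi)$, for $\varphi\in\mathcal{B}_X$, are $k$-linearly independent in $\mathbb{S}_{E,R^{op}}(X)$.
   Context: **Lattices.** In a finite lattice $T$ (least element $\hat0$, greatest element $\hat1$), an element $e$ is irreducible if $e=\bigvee_{a\in A}a$ with $A\subseteq T$ implies $e\in A$ (so $\hat0$ is not irreducible). $\mathrm{Irr}(T)=(E,R)$ denotes the set $E$ of irreducible elements with the order $R$ induced from $T$; $R^{op}$ is the opposite order. For $t\in T$: $r(t)$ is the join of all elements strictly smaller than $t$, and $r^\infty(t)$ is the stable value of the iterates $r^n(t)$; $\sigma(t)$ is the meet of all irreducible elements strictly larger than $t$ (empty meet $=\hat1$), and $\sigma^\infty(t)$ is the stable value of the iterates $\sigma^n(t)$. $\Lambda E$ is the set of all meets of (possibly empty) families of elements of $E$. $\widehat G$ is the set of $t\in T$ such that $t\notin\Lambda E$ and there is $e\in E$ with $t=r^\infty(e)$ and $\sigma(e)=e$. $G=G(T)=\Lambda E\sqcup\widehat G$ (equivalently $G=E\sqcup\{a\in T\mid a=r^\infty(\sigma^\infty(a))\}$). **Correspondences.** $\mathcal{C}(Y,X)$ is the set of all subsets of $Y\times X$; $SQ=\{(z,x)\mid\exists y\in Y,\ (z,y)\in S,\ (y,x)\in Q\}$ for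 $S\subseteq Z\times Y$, $Q\subseteq Y\times X$; $k\mathcal{C}(Y,X)$ is its $k$-linearization with bilinear composition. $\Delta_E=\{(e,e)\mid e\in E\}$, $\Delta_\alpha=\{(\alpha(e),e)\mid e\in E\}$ for a permutation $\alpha$ of $E$. **Fundamental functors and $\Theta$.** For a finite poset $(E,R)$, $\mathcal{P}_Ef_R$ is the left $k\mathcal{C}(E,E)$-module with $k$-basis $\{\Delta_\alpha f_R\}$, $\alpha$ running over the permutations of $E$ ($f_R:=\Delta_{\mathrm{id}}f_R$), where a relation $Q\in\mathcal{C}(E,E)$ acts by $Q\cdot\Delta_\alpha f_R=\Delta_{\beta\alpha}f_R$ if there is a (necessarily unique) permutation $\beta$ with $\Delta_E\subseteq\Delta_{\beta^{-1}}Q\subseteq\{(\alpha(e),\alpha(f))\mid(e,f)\in R\}$, and by $0$ otherwise. For a left $k\mathcal{C}(E,E)$-module $W$, $L_{E,W}(X)=k\mathcal{C}(X,E)\otimes_{k\mathcal{C}(E,E)}W$ and $J_{E,W}(X)=\{\sum_i\varphi_i\otimes w_i\mid\forall\rho\in k\mathcal{C}(E,X),\ \sum_i(\rho\varphi_i)\cdot w_i=0\}$. The fundamental functor is $\mathbb{S}_{E,R}=L_{E,\mathcal{P}_Ef_R}/J_{E,\mathcal{P}_Ef_R}$. $F_T(X)$ is the free $k$-module on the set $T^X$ of maps $X\to T$, and $\Theta_{T,X}:F_T(X)\to\mathbb{S}_{E,R^{op}}(X)$ is the $k$-linear map sending $\varphi:X\to T$ to the class of $\Gamma_\varphi\otimes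 f_{R^{op}}$, where $\Gamma_\varphi=\{(x,e)\in X\times E\mid e\leq\varphi(x)\}$. *)

(* Defs.v *)
From HB Require Import structures.
From mathcomp Require Import all_boot all_order all_algebra all_fingroup.
From mathcomp Require Import generic_quotient ring_quotient freeg boolp.

Set Implicit Arguments.
Unset Strict Implicit.
Unset Printing Implicit Defensive.

Import Order.TTheory GRing.Theory.

Local Open Scope quotient_scope.
Local Open Scope ring_scope.

Section Lattice.
Local Open Scope order_scope.
Variables (d : Order.disp_t) (T : finTBLatticeType d).
Implicit Types (t e : T) (A : {set T}).

(* [A := set0] excludes the bottom element. *)
Definition irr : {set T} :=
  [set e : T | [forall A : {set T}, (e == \join_(a in A) a) ==> (e \in A)]].

Definition lat_r t : T := \join_(s : T | s < t) s.
Definition lat_sigma t : T := \meet_(e in irr | t < e) e.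

(* The iterates of [lat_r] decrease, so they are constant from rank #|T| on:
   see [lat_r_infK]. *)
Definition lat_r_inf t : T := iter #|T| lat_r t.

Lemma iter_stable (f : T -> T) (le : rel T) :
  (forall x y, le x y -> le y x -> x = y) ->
  (forall x y z, le x y -> le y z -> le x z) -> (forall x, le x x) ->
  (forall x, le x (f x)) -> forall t, f (iter #|T| f t) = iter #|T| f t.
Proof.
move=> asym trans refl incr t.
have mono i j : (i <= j)%N -> le (iter i f t) (iter j f t).
  move=> ij; rewrite -(subnK ij); elim: (j - i)%N => //= n IH.
  exact: trans IH (incr _).
have: ~~ injectiveb (fun i : 'I_#|T|.+1 => iter i f t).
  by apply/negP => /injectiveP /leq_card; rewrite card_ord ltnn.
case/injectivePn => i [j neq_ij eq_ij].
wlog lt_ij : i j neq_ij eq_ij / (i < j)%N => [hw|].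
  case: (ltngtP i j) => [|lt_ji|/val_inj ij]; first exact: (hw i j).
    by apply: (hw j i); rewrite // eq_sym.
  by rewrite ij eqxx in neq_ij.
have fix_i : f (iter i f t) = iter i f t.
  apply: asym; last exact: incr.
  by rewrite [X in le _ X]eq_ij; exact: (mono i.+1 j).
have iT : (i <= #|T|)%N by rewrite -ltnS ltn_ord.
by rewrite -(subnK iT) iterD; elim: (#|T| - i)%N => //= n IH; rewrite !IH.
Qed.

Lemma lat_r_infK t : lat_r (lat_r_inf t) = lat_r_inf t.
Proof.
apply: (@iter_stable _ (fun x y => y <= x)) => //.
- by move=> x y yx xy; apply/eqP; rewrite eq_le xy yx.
- by move=> x y z yx zy; exact: le_trans zy yx.
- by move=> x; apply/joinsP => s /ltW.
Qed.

Definition meets_irr : {set T} :=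
  [set t | [exists A : {set T}, (A \subset irr) && (t == \meet_(a in A) a)]].

Definition G_hat : {set T} :=
  [set t | (t \notin meets_irr) &&
           [exists e in irr, (t == lat_r_inf e) && (lat_sigma e == e)]].

Definition G_set : {set T} := meets_irr :|: G_hat.

Definition irr_type := {e : T | e \in irr}.
HB.instance Definition _ := SubType.on irr_type.
HB.instance Definition _ := [Finite of irr_type by <:].
HB.instance Definition _ :=
  Order.SubChoice_isSubPOrder.Build d T (fun e : T => e \in irr) d irr_type.

End Lattice.

Definition corr (Y X : finType) := {set Y * X}.

Section Correspondences.
Implicit Types (W X Y Z : finType).

Definition corr_comp Z Y X (S : corr Z Y) (Q : corr Y X) : corr Z X :=
  [set p | [exists y, ((p.1, y) \in S) && ((y, p.2) \in Q)]].

Definition corr_perm (E : finType) (alpha : {perm E}) : corr E E :=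
  [set (alpha e, e) | e : E].

Definition corr_id (E : finType) : corr E E := [set (e, e) | e : E].

Lemma corr_compP Z Y X (S : corr Z Y) (Q : corr Y X) z x :
  reflect (exists2 y, (z, y) \in S & (y, x) \in Q) ((z, x) \in corr_comp S Q).
Proof.
rewrite inE; apply: (iffP existsP) => [[y /andP[]]|[y ? ?]]; first by exists y.
by exists y; apply/andP.
Qed.

Lemma corr_compA W Z Y X (S : corr W Z) (Q : corr Z Y) (V : corr Y X) :
  corr_comp S (corr_comp Q V) = corr_comp (corr_comp S Q) V.
Proof.
apply/setP => -[w x]; apply/corr_compP/corr_compP.
  by move=> [z wz /corr_compP[y zy yx]]; exists y => //; apply/corr_compP; exists z.
by move=> [y /corr_compP[z wz zy] yx]; exists z => //; apply/corr_compP; exists y.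
Qed.

Lemma in_corr_id (E : finType) (x y : E) : ((x, y) \in corr_id E) = (x == y).
Proof. by apply/imsetP/eqP => [[e _ [-> ->]]|->] //; exists y. Qed.

Lemma in_corr_perm (E : finType) (a : {perm E}) (x y : E) :
  ((x, y) \in corr_perm a) = (x == a y).
Proof. by apply/imsetP/eqP => [[e _ [-> ->]]|->] //; exists y. Qed.

Lemma corr_comp1l Y X (Q : corr Y X) : corr_comp (corr_id Y) Q = Q.
Proof.
apply/setP => -[y x]; apply/corr_compP/idP.
  by move=> [z]; rewrite in_corr_id => /eqP ->.
by exists y; rewrite ?in_corr_id.
Qed.

Lemma corr_comp1r Y X (Q : corr Y X) : corr_comp Q (corr_id X) = Q.
Proof.
apply/setP => -[y x]; apply/corr_compP/idP.
  by move=> [z]; rewrite in_corr_id => ? /eqP <-.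
by exists x; rewrite ?in_corr_id.
Qed.

End Correspondences.

(* An element of [linC k Y X] is the family of its coefficients. *)
Definition linC (k : comPzRingType) (Y X : finType) := {ffun corr Y X -> k^o}.

HB.instance Definition _ (k : comPzRingType) (Y X : finType) :=
  GRing.Lmodule.on (linC k Y X).

Section LinearizedCorrespondences.
Variable k : comPzRingType.
Implicit Types (W X Y Z : finType).

Definition lin_corr Y X (S : corr Y X) : linC k Y X := [ffun U => (U == S)%:R].

Definition lin_comp Z Y X (f : linC k Z Y) (g : linC k Y X) : linC k Z X :=
  [ffun U => \sum_(p : corr Z Y * corr Y X | corr_comp p.1 p.2 == U)
               f p.1 * g p.2 : k].

Lemma lin_compDl Z Y X (f f' : linC k Z Y) (g : linC k Y X) :
  lin_comp (f + f') g = lin_comp f g + lin_comp f' g.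
Proof.
apply/ffunP => U; rewrite !ffunE -big_split; apply: eq_bigr => p _ /=.
by rewrite ffunE mulrDl.
Qed.

Lemma lin_compDr Z Y X (f : linC k Z Y) (g g' : linC k Y X) :
  lin_comp f (g + g') = lin_comp f g + lin_comp f g'.
Proof.
apply/ffunP => U; rewrite !ffunE -big_split; apply: eq_bigr => p _ /=.
by rewrite ffunE mulrDr.
Qed.

Lemma lin_compZl Z Y X (c : k) (f : linC k Z Y) (g : linC k Y X) :
  lin_comp (c *: f) g = c *: lin_comp f g.
Proof.
apply/ffunP => U; rewrite !ffunE /GRing.scale /= mulr_sumr.
by apply: eq_bigr => p _; rewrite ffunE /GRing.scale /= mulrA.
Qed.

Lemma lin_compZr Z Y X (c : k) (f : linC k Z Y) (g : linC k Y X) :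
  lin_comp f (c *: g) = c *: lin_comp f g.
Proof.
apply/ffunP => U; rewrite !ffunE /GRing.scale /= mulr_sumr.
by apply: eq_bigr => p _; rewrite ffunE /GRing.scale /= mulrCA.
Qed.

Lemma lin_compA W Z Y X (f : linC k W Z) (g : linC k Z Y) (h : linC k Y X) :
  lin_comp f (lin_comp g h) = lin_comp (lin_comp f g) h.
Proof.
apply/ffunP => U; rewrite !ffunE.
transitivity (\sum_(p : corr W Z * (corr Z Y * corr Y X) |
   corr_comp p.1 (corr_comp p.2.1 p.2.2) == U)
   f p.1 * (g p.2.1 * h p.2.2) : k).
  transitivity (\sum_(p : corr W Z * corr Z X | corr_comp p.1 p.2 == U)
      \sum_(q : corr Z Y * corr Y X | corr_comp q.1 q.2 == p.2)
        f p.1 * (g q.1 * h q.2) : k).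
    by apply: eq_bigr => p _; rewrite ffunE mulr_sumr.
  rewrite -(pair_big_dep xpredT
    (fun S V => corr_comp S V == U) (fun S V =>
    \sum_(q | corr_comp q.1 q.2 == V) f S * (g q.1 * h q.2) : k)) /=.
  rewrite -(pair_big_dep xpredT
    (fun S q => corr_comp S (corr_comp q.1 q.2) == U)
    (fun S q => f S * (g q.1 * h q.2) : k)) /=.
  apply: eq_bigr => S _; rewrite [RHS](partition_big
    (fun q : corr Z Y * corr Y X => corr_comp q.1 q.2)
    (fun V => corr_comp S V == U)) //=.
  apply: eq_bigr => V /eqP SV; apply: eq_bigl => q.
  by case: eqP => [->|]; rewrite ?SV ?eqxx ?andbF.
transitivity (\sum_(p : (corr W Z * corr Z Y) * corr Y X |
   corr_comp (corr_comp p.1.1 p.1.2) p.2 == U)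
   (f p.1.1 * g p.1.2) * h p.2 : k).
  rewrite (reindex (fun p : (corr W Z * corr Z Y) * corr Y X =>
    (p.1.1, (p.1.2, p.2)))) /=.
    by apply: eq_big => [p|p _]; rewrite ?corr_compA ?mulrA.
  exists (fun p => ((p.1, p.2.1), p.2.2)) => [[[]]|[? []]] //.
transitivity (\sum_(p : corr W Y * corr Y X | corr_comp p.1 p.2 == U)
    \sum_(q : corr W Z * corr Z Y | corr_comp q.1 q.2 == p.1)
      (f q.1 * g q.2) * h p.2 : k); last first.
  by apply: eq_bigr => p _; rewrite ffunE mulr_suml.
rewrite -(pair_big_dep xpredT
    (fun V S => corr_comp V S == U) (fun V S =>
    \sum_(q | corr_comp q.1 q.2 == V) (f q.1 * g q.2) * h S : k)) /=.
rewrite -(pair_big_dep xpredT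
    (fun q S => corr_comp (corr_comp q.1 q.2) S == U)
    (fun q S => (f q.1 * g q.2) * h S : k)) /=.
rewrite [LHS](exchange_big_dep xpredT) //= [RHS](exchange_big_dep xpredT) //=.
apply: eq_bigr => S _; rewrite [LHS](partition_big
    (fun q : corr W Z * corr Z Y => corr_comp q.1 q.2)
    (fun V => corr_comp V S == U)) //=.
apply: eq_bigr => V /eqP SV; apply: eq_bigl => q.
by rewrite andbC; case: eqP => // ->; rewrite SV eqxx.
Qed.

Lemma lin_comp1l Y X (f : linC k Y X) : lin_comp (lin_corr (corr_id Y)) f = f.
Proof.
apply/ffunP => U; rewrite ffunE (bigD1 (corr_id Y, U)) /= ?corr_comp1l //.
rewrite ffunE eqxx mul1r big1 ?addr0 // => -[S Q] /= /andP[/eqP SQ neq].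
rewrite ffunE; case: eqP => [eqS|]; last by rewrite mul0r.
by move: neq; rewrite -SQ eqS corr_comp1l eqxx.
Qed.

Lemma lin_comp1r Y X (f : linC k Y X) : lin_comp f (lin_corr (corr_id X)) = f.
Proof.
apply/ffunP => U; rewrite ffunE (bigD1 (U, corr_id X)) /= ?corr_comp1r //.
rewrite ffunE eqxx mulr1 big1 ?addr0 // => -[S Q] /= /andP[/eqP SQ neq].
rewrite ffunE; case: eqP => [eqQ|]; last by rewrite mulr0.
by move: neq; rewrite -SQ eqQ corr_comp1r eqxx.
Qed.

End LinearizedCorrespondences.

HB.instance Definition _ (k : comPzRingType) (E : finType) :=
  GRing.Zmodule_isPzRing.Build (linC k E E)
    (@lin_compA k E E E E) (@lin_comp1l k E E) (@lin_comp1r k E E)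
    (@lin_compDl k E E E) (@lin_compDr k E E E).

Section FundamentalModule.
Variables (d : Order.disp_t) (E : finPOrderType d).
Implicit Types (Q : corr E E) (alpha beta gamma eta : {perm E}).

Definition twisted_order alpha : corr E E :=
  [set (alpha p.1, alpha p.2) | p : E * E & (p.1 <= p.2)%O].

Definition admissible Q alpha beta : bool :=
  (corr_id E \subset corr_comp (corr_perm beta^-1) Q) &&
  (corr_comp (corr_perm beta^-1) Q \subset twisted_order alpha).

(* The product of permutations is written left to right in MathComp:
   [alpha * beta] is the composite "alpha, then beta". *)
Definition perm_act Q alpha : option {perm E} :=
  omap (fun beta => (alpha * beta)%g) [pick beta | admissible Q alpha beta].

Lemma in_twisted_order alpha x y :
  ((x, y) \in twisted_order alpha) = ((alpha^-1)%g x <= (alpha^-1)%g y)%O.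
Proof.
apply/imsetP/idP => [[[e f]]|le_xy].
  by rewrite inE /= => ef [-> ->]; rewrite !permK.
by exists ((alpha^-1)%g x, (alpha^-1)%g y); rewrite ?inE /= ?permKV.
Qed.

Lemma in_perm_comp Q beta x y :
  ((x, y) \in corr_comp (corr_perm beta^-1) Q) = ((beta x, y) \in Q).
Proof.
apply/corr_compP/idP => [[z]|].
  by rewrite in_corr_perm => /eqP ->; rewrite permKV.
by exists (beta x); rewrite ?in_corr_perm ?permK.
Qed.

Lemma admissibleP Q alpha beta :
  reflect ((forall e, (beta e, e) \in Q) /\
           (forall x y, (beta x, y) \in Q ->
                        ((alpha^-1)%g x <= (alpha^-1)%g y)%O))
          (admissible Q alpha beta).
Proof.
apply: (iffP andP) => -[H1 H2]; split.
- move=> e; rewrite -in_perm_comp; apply: (subsetP H1).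
  by rewrite in_corr_id.
- by move=> x y; rewrite -in_perm_comp => /(subsetP H2); rewrite in_twisted_order.
- apply/subsetP => -[x y]; rewrite in_corr_id => /eqP ->.
  by rewrite in_perm_comp.
- by apply/subsetP => -[x y]; rewrite in_perm_comp in_twisted_order => /H2.
Qed.

Lemma decreasing_perm alpha : (forall e, (alpha e <= e)%O) -> alpha = 1%g.
Proof.
move=> dec; apply/permP => e; rewrite perm1; apply: le_anti; rewrite dec /=.
have decX n x : ((alpha ^+ n)%g x <= x)%O.
  elim: n x => [|n IH] x; first by rewrite perm1.
  by rewrite expgSr permM (le_trans (dec _)).
rewrite -{1}[e]perm1 -(expg_order alpha) -(prednK (order_gt0 alpha)).
by rewrite expgS permM decX.
Qed.

Lemma admissible_uniq Q alpha beta gamma :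
  admissible Q alpha beta -> admissible Q alpha gamma -> beta = gamma.
Proof.
move=> /admissibleP[Qb _] /admissibleP[_ Qg].
have: (alpha * (beta * gamma^-1) * alpha^-1)%g = 1%g.
  apply: decreasing_perm => e; rewrite !permM.
  by rewrite -{2}[e](permK alpha) Qg // permKV.
move/(canRL (mulgKV _)); rewrite mul1g => /(canRL (mulKg _)).
by rewrite mulVg => /(canRL (mulgKV _)); rewrite mul1g.
Qed.

Lemma perm_actP Q alpha gamma :
  (perm_act Q alpha == Some gamma) = admissible Q alpha (alpha^-1 * gamma)%g.
Proof.
rewrite /perm_act; case: pickP => [beta adm|noadm] /=; last by rewrite noadm.
apply/eqP/idP => [[<-]|adm']; first by rewrite mulKg.
by rewrite (admissible_uniq adm adm') mulKVg.
Qed.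

Lemma perm_act1 alpha : perm_act (corr_id E) alpha = Some alpha.
Proof.
apply/eqP; rewrite perm_actP mulVg; apply/admissibleP; split=> [e|x y].
  by rewrite perm1 in_corr_id.
by rewrite perm1 in_corr_id => /eqP ->.
Qed.

Lemma perm_act_comp Q1 Q2 alpha :
  perm_act (corr_comp Q1 Q2) alpha = obind (perm_act Q1) (perm_act Q2 alpha).
Proof.
have Some_ext (a b : option {perm E}) :
    (forall g, (a == Some g) = (b == Some g)) -> a = b.
  case: a b => [x|] [y|] // ab; first by move: (ab x); rewrite eqxx => /esym/eqP.
    by move: (ab x); rewrite eqxx.
  by move: (ab y); rewrite eqxx.
apply: Some_ext => gamma; rewrite perm_actP; apply/admissibleP/idP.
  set eta := (_ * _)%g => -[Qe Qle].
  have /fin_all_exists[g gP] e : exists z, (eta e, z) \in Q1 /\ (z, e) \in Q2.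
    by have /corr_compP[z] := Qe e; exists z.
  have g_inj : injective g.
    move=> x y gxy; apply: (@perm_inj _ (alpha^-1)%g); apply: le_anti.
    rewrite (Qle x y) ?(Qle y x) //; apply/corr_compP.
      by exists (g x); [rewrite gxy; have [] := gP y|have [] := gP x].
    by exists (g y); [rewrite -gxy; have [] := gP x|have [] := gP y].
  have gQ1 x : (eta x, g x) \in Q1 by have [] := gP x.
  have gQ2 x : (g x, x) \in Q2 by have [] := gP x.
  have -> : perm_act Q2 alpha = Some (alpha * perm g_inj)%g.
    apply/eqP; rewrite perm_actP mulKg; apply/admissibleP; split=> [e|x y].
      by rewrite permE.
    by rewrite permE => xy; apply: Qle; apply/corr_compP; exists (g x).
  rewrite /= perm_actP invMg -mulgA -/eta.
  apply/admissibleP; split=> [e|x y].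
    by rewrite permM -{2}[e](permKV (perm g_inj)) [X in (_, X)]permE.
  rewrite invMg !permM => xy; apply: Qle; apply/corr_compP.
  exists y; first by rewrite /eta permM.
  by rewrite -{1}[y](permKV (perm g_inj)) permE.
case E2: (perm_act Q2 alpha) => [beta|] //=; rewrite perm_actP.
move/eqP: E2; rewrite perm_actP => /admissibleP[Q2e Q2le] /admissibleP[Q1e Q1le].
have eq1 : (alpha^-1 * gamma = (alpha^-1 * beta) * (beta^-1 * gamma))%g.
  by rewrite -mulgA mulKVg.
split=> [e|x y].
  by apply/corr_compP; exists ((alpha^-1 * beta)%g e) => //; rewrite eq1 permM.
move=> /corr_compP[z xz zy].
have := Q1le ((alpha^-1 * beta)%g x) z; rewrite -permM -eq1 => /(_ xz).
rewrite -permM mulgK => /le_trans; apply.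
have := Q2le ((beta^-1 * alpha)%g z) y; rewrite -permM mulgA mulgK.
rewrite mulVg perm1 => /(_ zy); by rewrite -permM mulgK.
Qed.

End FundamentalModule.

(* An element is the family of its coefficients on the basis
   (Delta_alpha f_R), alpha in {perm E}. *)
Definition fund_mod (k : comPzRingType) (d : Order.disp_t)
  (E : finPOrderType d) := {ffun {perm E} -> k}.

HB.instance Definition _ (k : comPzRingType) (d : Order.disp_t)
  (E : finPOrderType d) := GRing.Zmodule.on (fund_mod k E).

Section FundamentalModuleAction.
Variables (k : comPzRingType) (d : Order.disp_t) (E : finPOrderType d).
Implicit Types (a b : linC k E E) (w : fund_mod k E).

Definition fund_gen : fund_mod k E := [ffun alpha => (alpha == 1%g)%:R].

Definition fund_act a w : fund_mod k E :=
  [ffun gamma => \sum_(p : corr E E * {perm E} | perm_act p.1 p.2 == Some gamma)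
                   a p.1 * w p.2 : k].

Lemma fund_actA a b w : fund_act a (fund_act b w) = fund_act (a * b) w.
Proof.
apply/ffunP => g; rewrite !ffunE.
transitivity (\sum_(p : (corr E E * corr E E) * {perm E} |
    obind (perm_act p.1.1) (perm_act p.1.2 p.2) == Some g)
    a p.1.1 * b p.1.2 * w p.2 : k).
  transitivity (\sum_(p : corr E E * {perm E} | perm_act p.1 p.2 == Some g)
      \sum_(q : corr E E * {perm E} | perm_act q.1 q.2 == Some p.2)
        a p.1 * (b q.1 * w q.2) : k).
    by apply: eq_bigr => p _; rewrite ffunE mulr_sumr.
  transitivity (\sum_(p : corr E E * (corr E E * {perm E}) |
      obind (perm_act p.1) (perm_act p.2.1 p.2.2) == Some g)
      a p.1 * (b p.2.1 * w p.2.2) : k).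
    rewrite -(pair_big_dep xpredT
      (fun S V => perm_act S V == Some g) (fun S V =>
      \sum_(q : corr E E * {perm E} | perm_act q.1 q.2 == Some V)
         a S * (b q.1 * w q.2) : k)) /=.
    rewrite -(pair_big_dep xpredT
      (fun S (q : corr E E * {perm E}) =>
         obind (perm_act S) (perm_act q.1 q.2) == Some g)
      (fun S q => a S * (b q.1 * w q.2) : k)) /=.
    apply: eq_bigr => S _; rewrite [RHS](partition_big
      (fun q : corr E E * {perm E} => odflt 1%g (perm_act q.1 q.2))
      (fun V => perm_act S V == Some g)) /=; last first.
      by move=> [q1 q2] /=; case: (perm_act q1 q2).
    apply: eq_bigr => V SV; apply: eq_bigl => -[q1 q2] /=.
    case: (perm_act q1 q2) => [x|] //=.
    by rewrite andbC; apply/eqP/andP => [[->]|[/eqP ->]].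
  rewrite [RHS](reindex (fun p : corr E E * (corr E E * {perm E}) =>
    ((p.1, p.2.1), p.2.2))) /=; first by apply: eq_bigr => p _; rewrite mulrA.
  by exists (fun p => (p.1.1, (p.1.2, p.2))) => [[? []]|[[]]].
transitivity (\sum_(p : corr E E * {perm E} | perm_act p.1 p.2 == Some g)
    \sum_(q : corr E E * corr E E | corr_comp q.1 q.2 == p.1)
      (a q.1 * b q.2) * w p.2 : k); last first.
  by apply: eq_bigr => p _; rewrite ffunE mulr_suml.
rewrite -(pair_big_dep xpredT
    (fun V S => perm_act V S == Some g) (fun V S =>
    \sum_(q : corr E E * corr E E | corr_comp q.1 q.2 == V)
      (a q.1 * b q.2) * w S : k)) /=.
rewrite -(pair_big_dep xpredT
    (fun (q : corr E E * corr E E) S =>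
       obind (perm_act q.1) (perm_act q.2 S) == Some g)
    (fun q S => (a q.1 * b q.2) * w S : k)) /=.
rewrite [LHS](exchange_big_dep xpredT) //= [RHS](exchange_big_dep xpredT) //=.
apply: eq_bigr => S _; rewrite [LHS](partition_big
    (fun q : corr E E * corr E E => corr_comp q.1 q.2)
    (fun V => perm_act V S == Some g)) /=; last first.
  by move=> q; rewrite perm_act_comp.
apply: eq_bigr => V SV; apply: eq_bigl => q.
by rewrite andbC -perm_act_comp; case: eqP => // ->; rewrite SV.
Qed.

Lemma fund_act1 : left_id 1 fund_act.
Proof.
move=> w; apply/ffunP => g; rewrite ffunE.
rewrite (bigD1 (corr_id E, g)) /= ?perm_act1 // ffunE eqxx mul1r.
rewrite big1 ?addr0 // => -[S Q] /= /andP[SQ neq].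
rewrite ffunE; case: eqP => [eqS|]; last by rewrite mul0r.
move: SQ; rewrite eqS perm_act1 => /eqP[Qg].
by rewrite eqS Qg eqxx in neq.
Qed.

Lemma fund_actDr : right_distributive fund_act +%R.
Proof.
move=> a w w'; apply/ffunP => g; rewrite !ffunE -big_split.
by apply: eq_bigr => p _ /=; rewrite ffunE mulrDr.
Qed.

Lemma fund_actDl w : {morph fund_act^~ w : a b / a + b}.
Proof.
move=> a b; apply/ffunP => g; rewrite !ffunE -big_split.
by apply: eq_bigr => p _ /=; rewrite ffunE mulrDl.
Qed.

HB.instance Definition _ := GRing.Zmodule_isLmodule.Build
  (linC k E E) (fund_mod k E) fund_actA fund_act1 fund_actDr fund_actDl.

End FundamentalModuleAction.

Section Span.
Variables (V : zmodType) (gen : V -> Prop).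

Definition zspan : {pred V} := fun x =>
  `[< forall S : {pred V}, GRing.zmod_closed S ->
        (forall y, gen y -> y \in S) -> x \in S >].

Lemma zspanP x :
  reflect (forall S : {pred V}, GRing.zmod_closed S ->
             (forall y, gen y -> y \in S) -> x \in S)
          (x \in zspan).
Proof. exact: asboolP. Qed.

Lemma mem_zspan x : gen x -> x \in zspan.
Proof. by move=> gx; apply/zspanP => S _; apply. Qed.

Fact zspan_closed : GRing.zmod_closed zspan.
Proof.
split; first by apply/zspanP => S [].
move=> x y /zspanP xS /zspanP yS; apply/zspanP => S Sc gS.
by case: (Sc) => _; apply; [apply: xS|apply: yS].
Qed.

HB.instance Definition _ := GRing.isZmodClosed.Build V zspan zspan_closed.

End Span.

Section ModuleQuotient.
Variables (k : pzRingType) (V : lmodType k) (I : submodClosed V).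

Fact submod_closed_zmod : zmod_closed I.
Proof. exact: GRing.submod_closedB (submodClosedP I). Qed.

Definition submod_pred : {pred V} := I.
HB.instance Definition _ :=
  GRing.isZmodClosed.Build V submod_pred submod_closed_zmod.

Definition mod_quot := Quotient.quot submod_pred.
HB.instance Definition _ := GRing.Zmodule.on mod_quot.

Definition mod_pi (v : V) : mod_quot := \pi_(Quotient.quot submod_pred) v.

Definition mod_scale (c : k) (x : mod_quot) : mod_quot :=
  mod_pi (c *: repr (x : Quotient.quot submod_pred)).

Lemma mod_piP u v : reflect (mod_pi u = mod_pi v) (u - v \in I).
Proof.
rewrite -[_ \in I]/(u - v \in submod_pred) Quotient.idealrBE.
exact: eqP.
Qed.

Lemma mod_piK (x : mod_quot) : mod_pi (repr (x : Quotient.quot submod_pred)) = x.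
Proof. exact: reprK. Qed.

Lemma mod_pi_is_additive : zmod_morphism mod_pi.
Proof. exact: (raddfB (\pi_(Quotient.quot submod_pred))). Qed.

HB.instance Definition _ :=
  GRing.isZmodMorphism.Build V mod_quot mod_pi mod_pi_is_additive.

Lemma mod_pi_scale c v : mod_pi (c *: v) = mod_scale c (mod_pi v).
Proof.
apply/mod_piP; rewrite -scalerBr rpredZ //.
by apply/mod_piP; rewrite mod_piK.
Qed.

Fact mod_scaleA a b x : mod_scale a (mod_scale b x) = mod_scale (a * b) x.
Proof. by rewrite -[x]mod_piK -!mod_pi_scale scalerA. Qed.

Fact mod_scale1 : left_id 1 mod_scale.
Proof. by move=> x; rewrite -[x]mod_piK -!mod_pi_scale scale1r. Qed.

Fact mod_scaleDr : right_distributive mod_scale +%R.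
Proof.
move=> a x y; rewrite -[x]mod_piK -[y]mod_piK.
by rewrite -raddfD -!mod_pi_scale scalerDr raddfD.
Qed.

Fact mod_scaleDl x : {morph mod_scale^~ x : a b / a + b}.
Proof.
by move=> a b; rewrite -[x]mod_piK -!mod_pi_scale scalerDl raddfD.
Qed.

HB.instance Definition _ := GRing.Zmodule_isLmodule.Build k mod_quot
  mod_scaleA mod_scale1 mod_scaleDr mod_scaleDl.

HB.instance Definition _ :=
  GRing.isScalable.Build k V mod_quot *:%R mod_pi mod_pi_scale.

End ModuleQuotient.

Section TensorProduct.
Variables (k : comPzRingType) (E X : finType) (W : lmodType (linC k E E)).

Local Notation free := {freeg (linC k X E * W)%type / int}.

Definition free_tens (phi : linC k X E) (w : W) : free := << (phi, w) >>.

(* Defining relations of the tensor product of the right module kC(X,E)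
   and the left module W over the ring kC(E,E). *)
Inductive tensor_rel : free -> Prop :=
| TensorDl phi phi' w :
    tensor_rel (free_tens (phi + phi') w - (free_tens phi w + free_tens phi' w))
| TensorDr phi w w' :
    tensor_rel (free_tens phi (w + w') - (free_tens phi w + free_tens phi w'))
| TensorA phi a w :
    tensor_rel (free_tens (lin_comp phi a) w - free_tens phi (a *: w)).

(* L_{E,W}(X) *)
Definition L_fun := Quotient.quot (zspan tensor_rel).
HB.instance Definition _ := GRing.Zmodule.on L_fun.

Definition L_pi (u : free) : L_fun := \pi_(Quotient.quot (zspan tensor_rel)) u.

Definition tens (phi : linC k X E) (w : W) : L_fun := L_pi (free_tens phi w).

(* The k-module structure of L_fun is c (phi (x) w) = (c phi) (x) w. *)
Definition free_scale (c : k) : free -> free :=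
  fglift (fun p => free_tens (c *: p.1) p.2).

Definition L_scale (c : k) (t : L_fun) : L_fun :=
  L_pi (free_scale c (repr (t : Quotient.quot (zspan tensor_rel)))).

Lemma L_piP (u v : free) : reflect (L_pi u = L_pi v) (u - v \in zspan tensor_rel).
Proof. by rewrite Quotient.idealrBE; exact: eqP. Qed.

Lemma L_piK (t : L_fun) : L_pi (repr (t : Quotient.quot (zspan tensor_rel))) = t.
Proof. exact: reprK. Qed.

Fact L_pi_is_additive : zmod_morphism L_pi.
Proof. exact: (raddfB (\pi_(Quotient.quot (zspan tensor_rel)))). Qed.

HB.instance Definition _ :=
  GRing.isZmodMorphism.Build free L_fun L_pi L_pi_is_additive.

Fact free_scale_is_additive c : zmod_morphism (free_scale c).
Proof. exact: lift_is_additive. Qed.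

HB.instance Definition _ c :=
  GRing.isZmodMorphism.Build free free (free_scale c) (free_scale_is_additive c).

Lemma free_scaleU c phi w :
  free_scale c (free_tens phi w) = free_tens (c *: phi) w.
Proof. by rewrite /free_scale /free_tens liftU scale1r. Qed.

Lemma freeg_additive_eq (V : zmodType) (f g : {additive free -> V}) :
  (forall phi w, f (free_tens phi w) = g (free_tens phi w)) -> f =1 g.
Proof.
move=> fg u; rewrite -[u]freeg_sumE !raddf_sum; apply: eq_bigr => -[phi w] _.
rewrite -[coeff _ _]intz -freegU_mulz !raddfMz.
by rewrite -[<< _ >>]/(free_tens phi w) fg.
Qed.

Lemma L_ind (P : L_fun -> Prop) : P 0 ->
  (forall s t, P s -> P t -> P (s - t)) ->
  (forall phi w, P (tens phi w)) -> forall t, P t.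
Proof.
move=> P0 PB PT t; rewrite -[t]L_piK; move: (repr _) => u.
rewrite -[u]freeg_sumE raddf_sum; elim: (dom u) => [|[phi w] s IH].
  by rewrite big_nil.
have PN x : P x -> P (- x) by rewrite -sub0r; exact: (PB).
have PD x y : P x -> P y -> P (x + y) by move=> Px /PN; rewrite -{2}[y]opprK; exact: (PB).
rewrite big_cons; apply: (PD) => //.
rewrite -[coeff _ _]intz -freegU_mulz raddfMz.
have Pn n : P (tens phi w *+ n).
  by elim: n => [|n IHn]; rewrite ?mulr0n // mulrS; apply: (PD).
by case: (coeff _ _) => n; rewrite ?NegzE ?mulrNz -pmulrn; [|apply: PN]; exact: Pn.
Qed.

Lemma tensDl phi phi' w : tens (phi + phi') w = tens phi w + tens phi' w.
Proof. by rewrite /tens -raddfD; apply/L_piP/mem_zspan; exact: TensorDl. Qed.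

Lemma tensDr phi w w' : tens phi (w + w') = tens phi w + tens phi w'.
Proof. by rewrite /tens -raddfD; apply/L_piP/mem_zspan; exact: TensorDr. Qed.

Lemma tensA phi a w : tens (lin_comp phi a) w = tens phi (a *: w).
Proof. by apply/L_piP/mem_zspan; exact: TensorA. Qed.

Lemma free_scale_zspan c u :
  u \in zspan tensor_rel -> free_scale c u \in zspan tensor_rel.
Proof.
pose S : {pred free} := fun v => free_scale c v \in zspan tensor_rel.
move=> /zspanP /(_ S); apply.
  split=> [|x y]; rewrite /in_mem /= /S ?raddf0 ?rpred0 //.
  by move=> xS yS; rewrite raddfB rpredB.
move=> _ [phi phi' w|phi w w'|phi a w]; rewrite /in_mem /= /S.
- rewrite raddfB raddfD /= !free_scaleU scalerDr.
  by apply: mem_zspan; exact: TensorDl.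
- by rewrite raddfB raddfD /= !free_scaleU; apply: mem_zspan; exact: TensorDr.
- rewrite raddfB /= !free_scaleU -lin_compZl.
  by apply: mem_zspan; exact: TensorA.
Qed.

Lemma L_pi_scale c u : L_scale c (L_pi u) = L_pi (free_scale c u).
Proof.
apply/L_piP; rewrite -raddfB; apply: free_scale_zspan.
by apply/L_piP; rewrite L_piK.
Qed.

Lemma L_scale_tens c phi w : L_scale c (tens phi w) = tens (c *: phi) w.
Proof. by rewrite /tens L_pi_scale free_scaleU. Qed.

Fact L_scaleB c s t : L_scale c (s - t) = L_scale c s - L_scale c t.
Proof.
rewrite -[s]L_piK -[t]L_piK -raddfB !L_pi_scale.
by rewrite raddfB raddfB.
Qed.

Fact L_scale0 c : L_scale c 0 = 0.
Proof. by have := L_scaleB c 0 0; rewrite !subrr. Qed.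

Fact L_scaleA a b t : L_scale a (L_scale b t) = L_scale (a * b) t.
Proof.
elim/L_ind: t => [|s t sE tE|phi w]; first by rewrite !L_scale0.
  by rewrite !L_scaleB sE tE.
by rewrite !L_scale_tens scalerA.
Qed.

Fact L_scale1 : left_id 1 L_scale.
Proof.
elim/L_ind => [|s t sE tE|phi w]; first by rewrite L_scale0.
  by rewrite L_scaleB sE tE.
by rewrite L_scale_tens scale1r.
Qed.

Fact L_scaleDr : right_distributive L_scale +%R.
Proof.
move=> c s t; have LN : L_scale c (- t) = - L_scale c t.
  by rewrite -[- t]sub0r L_scaleB L_scale0 sub0r.
by rewrite -[t in LHS]opprK L_scaleB LN opprK.
Qed.

Fact L_scaleDl t : {morph L_scale^~ t : a b / a + b}.
Proof.
move=> a b; elim/L_ind: t => [|s t sE tE|phi w]; first by rewrite !L_scale0 addr0.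
  by rewrite !L_scaleB sE tE opprD addrACA.
by rewrite !L_scale_tens scalerDl tensDl.
Qed.

HB.instance Definition _ := GRing.Zmodule_isLmodule.Build k L_fun
  L_scaleA L_scale1 L_scaleDr L_scaleDl.

Lemma tensZ c phi w : c *: tens phi w = tens (c *: phi) w.
Proof. exact: L_scale_tens. Qed.

(* J_{E,W}(X) *)
Definition J_fun : {pred L_fun} := fun t =>
  `[< exists2 s : seq (linC k X E * W),
        t = \sum_(p <- s) tens p.1 p.2 &
        forall rho : linC k E X, \sum_(p <- s) lin_comp rho p.1 *: p.2 = 0 >].

Fact J_fun_closed : GRing.subsemimod_closed J_fun.
Proof.
split; [split|].
- by apply/asboolP; exists [::]; [|move=> rho]; rewrite big_nil.
- move=> _ _ /asboolP[s -> s0] /asboolP[t -> t0]; apply/asboolP.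
  by exists (s ++ t); [|move=> rho]; rewrite big_cat //= s0 t0 addr0.
move=> c _ /asboolP[s -> s0]; apply/asboolP.
exists [seq (c *: p.1, p.2) | p <- s]; last first.
  move=> rho; rewrite big_map /= -[RHS](s0 (c *: rho)).
  by apply: eq_bigr => p _; rewrite lin_compZl lin_compZr.
by rewrite big_map scaler_sumr; apply: eq_bigr => p _; rewrite tensZ.
Qed.

HB.instance Definition _ := GRing.isSubmodClosed.Build k L_fun J_fun J_fun_closed.

End TensorProduct.

Section FundamentalFunctor.
Variables (k : comPzRingType) (d : Order.disp_t) (E : finPOrderType d).
Variable X : finType.

(* S_{E,R}(X), where R is the order of E *)
Definition fund_fun := mod_quot (@J_fun k E X (fund_mod k E)).
HB.instance Definition _ := GRing.Lmodule.on fund_fun.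

Definition fund_class (t : L_fun X (fund_mod k E)) : fund_fun := mod_pi _ t.

End FundamentalFunctor.

Section Theta.
Variables (k : comPzRingType) (d : Order.disp_t) (T : finTBLatticeType d).
Variable X : finType.

(* An element is the family of its coefficients on the basis of maps X -> T. *)
Definition F_fun := {ffun {ffun X -> T} -> k^o}.
HB.instance Definition _ := GRing.Lmodule.on F_fun.

Definition F_basis (phi : {ffun X -> T}) : F_fun := [ffun psi => (psi == phi)%:R].

(* The poset (E, R^op) is the order dual [(irr_type T)^d]. *)
Definition Gamma (phi : {ffun X -> T}) : corr X (irr_type T)^d :=
  [set p : X * irr_type T | (val p.2 <= phi p.1)%O].

Definition Theta (a : F_fun) : fund_fun k (irr_type T)^d X :=
  \sum_phi a phi *:
    fund_class (tens (lin_corr k (Gamma phi)) (fund_gen k (irr_type T)^d)).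

Fact Theta_is_linear : linear Theta.
Proof.
move=> c a b; rewrite /Theta scaler_sumr -big_split; apply: eq_bigr => phi _ /=.
by rewrite !ffunE scalerDl scalerA.
Qed.

HB.instance Definition _ := GRing.isLinear.Build k F_fun _ _ Theta Theta_is_linear.

Lemma Theta_basis phi : Theta (F_basis phi) =
  fund_class (tens (lin_corr k (Gamma phi)) (fund_gen k (irr_type T)^d)).
Proof.
rewrite /Theta (bigD1 phi) //= ffunE eqxx scale1r big1 ?addr0 // => psi.
by rewrite ffunE => /negPf ->; rewrite scale0r.
Qed.

Definition B_set : {set {ffun X -> T}} :=
  [set phi : {ffun X -> T} | (irr T \subset phi @: X) && (phi @: X \subset G_set T)].

End Theta.

(* Main.v *)
Require Import Defs.
From mathcomp Require Import all_boot all_order all_algebra all_fingroup.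
From mathcomp Require Import freeg boolp.

(* Evaluating a relation sum_phi c_phi Theta(phi) = 0 against Q in C(E,X), and
   reading the coefficient of f_{R^op}, gives sum_phi c_phi N(Q,phi) = 0, where
   N(Q,phi) = 1 iff phi(x) <= a for all (a,x) in Q and every e in E is attained by
   phi at some x with (e,x) in Q.  A map psi : X -> G yields such a Q: the x-th
   condition is phi(x) <= psi(x) if psi(x) is in Lambda E; if psi(x) = t is in
   G-hat, with t = r^oo(e) and sigma(e) = e, it is phi(x) <= e, imposed through the
   irreducibles > e, so that x cannot witness that phi attains e.
   Everything <= e is either <= t or lies on the chain e > r(e) > ... > t.  Going
   down these chains, inclusion-exclusion over the positions where psi takes the
   value f or t, f on the chain of t, replaces "phi attains f" by "phi = f
   where psi = f, and phi <> f where psi = t".  Once all chains are treated, the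
   conditions attached to psi force phi <= psi pointwise and hold for phi = psi
   in B_X: the system has become triangular. *)

Import GRing.Theory.
Import Order.TTheory.
Local Open Scope ring_scope.

(** * Irreducibles and reduction chains in a finite lattice *)

Section LatticeChains.
Local Open Scope order_scope.
Context {d : Order.disp_t} {T : finTBLatticeType d}.
Implicit Types (s t e g h : T).

Lemma lat_r_le t : lat_r t <= t.
Proof. by apply/joinsP => s /ltW. Qed.

Lemma lt_lat_r s t : s < t -> s <= lat_r t.
Proof. by move=> st; exact: joins_sup. Qed.

Lemma irrNP t :
  reflect (exists2 A : {set T}, t = \join_(a in A) a & forall a, a \in A -> a < t)
    (t \notin irr T).
Proof.
rewrite inE negb_forall; apply: (iffP existsP) => [[A]|[A tA ltA]].
  rewrite negb_imply => /andP[/eqP tA tnA]; exists A => // a aA.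
  rewrite lt_neqAle {2}tA joins_sup // andbT.
  by apply: contraNneq tnA => <-.
exists A; rewrite negb_imply tA eqxx -tA /=.
by apply/negP => /ltA; rewrite ltxx.
Qed.

Lemma lat_r_id t : t \notin irr T -> lat_r t = t.
Proof.
move=> /irrNP[A tA ltA]; apply: le_anti; rewrite lat_r_le /= [X in X <= _]tA.
by apply/joinsP => a /ltA; exact: lt_lat_r.
Qed.

(** Induction on the number of elements strictly below [t]: a [t] that is not irreducible is a join
    of strictly smaller elements. *)
Lemma le_irr t u : (forall e, e \in irr T -> e <= t -> e <= u) -> t <= u.
Proof.
have [n] := ubnP #|[set s | s < t]|; elim: n t => // n IH t tn lt_u.
have [/lt_u|/irrNP[A tA ltA]] := boolP (t \in irr T); first exact.
rewrite tA; apply/joinsP => a /ltA a_t; apply: IH => [|e eI ea]; last first.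
  by apply: lt_u => //; exact: le_trans ea (ltW a_t).
move: tn; rewrite ltnS; apply: leq_trans; apply: proper_card.
apply/properP; split; last by exists a; rewrite !inE ?ltxx.
by apply/subsetP => s; rewrite !inE => /lt_trans; apply.
Qed.

Lemma iter_lat_r_le n t : iter n (@lat_r d T) t <= t.
Proof. by elim: n => //= n IH; exact: le_trans (lat_r_le _) IH. Qed.

Lemma lat_r_inf_iter n t : lat_r_inf (iter n (@lat_r d T) t) = lat_r_inf t.
Proof.
elim: n => //= n IH; rewrite -IH -(lat_r_infK (iter n _ t)).
by rewrite /lat_r_inf -[RHS]iterS iterSr.
Qed.

Lemma le_iter_lat_r n h t : h <= t ->
  h <= iter n (@lat_r d T) t \/ exists i, h = iter i (@lat_r d T) t.
Proof.
move=> ht; elim: n => [|n [|]] /=; [by left| |by right].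
rewrite le_eqVlt => /orP[/eqP ->|/lt_lat_r]; last by left.
by right; exists n.
Qed.

(** If [h] occurs among the iterates and is not irreducible, [lat_r] fixes it, so the chain already
    ends there. *)
Lemma le_lat_r_inf h t : h <= t ->
  h <= lat_r_inf t \/ h \in irr T /\ lat_r_inf h = lat_r_inf t.
Proof.
move=> /(le_iter_lat_r #|T|)[|[i hi]]; first by left.
have hr : lat_r_inf h = lat_r_inf t by rewrite hi lat_r_inf_iter.
have [|/lat_r_id rh] := boolP (h \in irr T); first by right.
left; rewrite -hr /lat_r_inf; elim: #|T| => //= n IH.
by rewrite -{1}rh; suff -> : iter n (@lat_r d T) h = h; [|elim: n {IH} => //= n ->].
Qed.

Lemma irr_meets_irr : irr T \subset meets_irr T.
Proof.
apply/subsetP => e eI; rewrite inE; apply/existsP; exists [set e].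
by rewrite big_set1 eqxx sub1set eI.
Qed.

Lemma le_meets_irr t u : u \in meets_irr T ->
  (forall e, e \in irr T -> u <= e -> t <= e) -> t <= u.
Proof.
rewrite inE => /existsP[A /andP[/subsetP AE /eqP ->]] tA.
by apply/meetsP => a aA; apply: tA; [exact: AE|exact: meets_inf].
Qed.

(** One chain is chosen for each point of G-hat, where a suitable [e] exists; the default [t] can
    occur only elsewhere. *)
Definition hat_top t : T :=
  odflt t [pick e in irr T | (t == lat_r_inf e) && (lat_sigma e == e)].

Lemma hat_topP t : t \in G_hat T ->
  [/\ hat_top t \in irr T, lat_r_inf (hat_top t) = t
    & lat_sigma (hat_top t) = hat_top t].
Proof.
rewrite inE => /andP[_ /exists_inP[e eI /andP[te se]]]; rewrite /hat_top.
case: pickP => [f /and3P[fI /eqP <- /eqP ->] //|/(_ e)].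
by rewrite eI te se.
Qed.

Lemma G_hat_irrN t : t \in G_hat T -> t \notin irr T.
Proof. by rewrite inE => /andP[+ _]; apply: contra => /(subsetP irr_meets_irr). Qed.

(** All chains at once, without their end points: [lat_r_inf] identifies the chain, and
    irreducibility removes its end point in G-hat. *)
Definition hat_chain : {set T} :=
  [set e in irr T | (lat_r_inf e \in G_hat T) && (e <= hat_top (lat_r_inf e))].

Lemma le_hat_top t h : t \in G_hat T -> h <= hat_top t ->
  h <= t \/ h \in hat_chain /\ lat_r_inf h = t.
Proof.
move=> tG ht; have [_ rt _] := hat_topP t tG.
case: (le_lat_r_inf h _ ht); rewrite rt; first by left.
by case=> hI hr; right; rewrite inE hI hr tG ht.
Qed.

Lemma hat_chain_total e h : e \in hat_chain -> h \in hat_chain ->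
  lat_r_inf e = lat_r_inf h -> (e <= h) || (h <= e).
Proof.
have chainE f : f \in hat_chain ->
    exists i, f = iter i (@lat_r d T) (hat_top (lat_r_inf f)).
  rewrite inE => /and3P[fI fG fle]; have [_ rt _] := hat_topP _ fG.
  case: (le_iter_lat_r #|T| _ _ fle) => // fr.
  suff fE : f = lat_r_inf f by rewrite fE (negPf (G_hat_irrN _ fG)) in fI.
  apply: le_anti; rewrite iter_lat_r_le andbT; by rewrite -rt.
move=> /chainE eC /chainE hC eh; move: eC hC; rewrite -eh.
move: (hat_top _) => x [i ->] [j ->].
have mono n m : (n <= m)%N -> iter m (@lat_r d T) x <= iter n (@lat_r d T) x.
  by move=> nm; rewrite -(subnK nm) iterD; exact: iter_lat_r_le.
by case/orP: (leq_total j i) => /mono ->; rewrite ?orbT.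
Qed.

End LatticeChains.

(** * Evaluation of tensors and the quotient by [J_fun] *)

Section Evaluation.
Context {k : comPzRingType} {E X : finType} {W : lmodType (linC k E E)}.
Implicit Types (s : seq (linC k X E * W)) (rho : linC k E X).

(** Evaluation at [rho] is defined on the free group and vanishes on the three kinds of tensor
    relations, hence descends to the tensor product. *)
Lemma tens_sum_eq0 s rho :
  \sum_(p <- s) tens p.1 p.2 = 0 ->
  \sum_(p <- s) lin_comp rho p.1 *: p.2 = 0.
Proof.
pose ev := fglift (fun p : linC k X E * W => lin_comp rho p.1 *: p.2 : zmodule W).
have evB : {morph ev : u v / u - v} by exact: lift_is_additive.
have ev0 : ev 0 = 0 by rewrite -(subrr 0) evB subrr.
have evD : {morph ev : u v / u + v}.
  by move=> u v; rewrite -[v in LHS]opprK evB -[- v]sub0r evB ev0 sub0r opprK.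
have evU phi w : ev (free_tens phi w) = lin_comp rho phi *: w.
  by rewrite /ev /free_tens liftU scale1r.
have -> : \sum_(p <- s) tens p.1 p.2 = L_pi (\sum_(p <- s) free_tens p.1 p.2).
  by rewrite raddf_sum.
have -> : \sum_(p <- s) lin_comp rho p.1 *: p.2
    = ev (\sum_(p <- s) free_tens p.1 p.2).
  rewrite (big_morph _ evD ev0); apply: eq_bigr => p _; exact/esym/evU.
set u := \sum_(p <- s) _ => u0.
have /L_piP : L_pi u = L_pi 0 by rewrite u0 raddf0.
rewrite subr0 => /zspanP /(_ (fun v => ev v == 0)) uS; apply/eqP/uS => {u u0 uS}.
  split=> [|x y]; rewrite unfold_in /= ?ev0 // => /eqP x0 /eqP y0.
  by rewrite unfold_in /= evB x0 y0 subrr.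
move=> _ [phi phi' w|phi w w'|phi a w]; rewrite unfold_in /= evB ?evD !evU.
- by rewrite lin_compDr scalerDl subrr.
- by rewrite scalerDr subrr.
- by rewrite lin_compA scalerA subrr.
Qed.

(** Membership in [J_fun] provides one representation with vanishing evaluations; its difference
    from [s] represents zero, which transfers the vanishing to [s]. *)
Lemma J_fun_sum s rho : \sum_(p <- s) tens p.1 p.2 \in @J_fun k E X W ->
  \sum_(p <- s) lin_comp rho p.1 *: p.2 = 0.
Proof.
move=> /asboolP[s' ss' s'0].
have := @tens_sum_eq0 (s ++ [seq (-1 *: p.1, p.2) | p <- s']) rho.
rewrite !big_cat !big_map /= ss'.
rewrite [X in _ + X](eq_bigr (fun p => - tens p.1 p.2)); last first.
  by move=> p _; rewrite -tensZ scaleN1r.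
rewrite sumrN subrr => /(_ erefl).
rewrite [X in _ + X](eq_bigr (fun p => - (lin_comp rho p.1 *: p.2))).
  by rewrite sumrN s'0 subr0.
by move=> p _; rewrite lin_compZr !scaleN1r scaleNr.
Qed.

End Evaluation.

(** * Linear equations obtained by evaluation *)

Lemma lin_comp_corr (k : comPzRingType) (Z Y X : finType) (S : corr Z Y) (Q : corr Y X) :
  lin_comp (lin_corr k S) (lin_corr k Q) = lin_corr k (corr_comp S Q).
Proof.
apply/ffunP => U; rewrite !ffunE big_mkcond (bigD1 (S, Q)) //= big1.
  by rewrite !ffunE !eqxx mulr1 addr0 eq_sym; case: eqP.
move=> [S' Q'] /=; rewrite xpair_eqE negb_and => /orP[] /negPf neq.
  by rewrite !ffunE neq mul0r if_same.
by rewrite !ffunE neq mulr0 if_same.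
Qed.

Lemma scale_fund_gen (k : comPzRingType) (d : Order.disp_t) (E : finPOrderType d)
    (c : k) (S : corr E E) (g : {perm E}) :
  ((c *: lin_corr k S) *: fund_gen k E) g = c *+ admissible S 1 g.
Proof.
transitivity (fund_act (c *: lin_corr k S) (fund_gen k E) g); first by [].
rewrite ffunE big_mkcond (bigD1 (S, 1%g)) //= big1.
  rewrite perm_actP invg1 mul1g !ffunE !eqxx addr0 /GRing.scale /= !mulr1.
  by case: admissible.
move=> [S' a] /=; rewrite xpair_eqE negb_and => /orP[] /negPf neq.
  by rewrite !ffunE neq /GRing.scale /= mulr0 mul0r if_same.
by rewrite !ffunE neq mulr0 if_same.
Qed.

Section Rows.
Context {k : comPzRingType} {d : Order.disp_t} {T : finTBLatticeType d} {X : finType}.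
Implicit Types (phi : {ffun X -> T}) (Q : corr (irr_type T)^d X).

Lemma Theta_row (B : {set {ffun X -> T}}) (c : {ffun X -> T} -> k) Q :
  \sum_(phi in B) c phi *: Theta (F_basis k phi) = 0 ->
  \sum_(phi in B) c phi *+ admissible (corr_comp Q (Gamma phi)) 1 1 = 0.
Proof.
set E := (irr_type T)^d.
pose s := [seq (c phi *: lin_corr k (Gamma phi), fund_gen k E) | phi <- enum B].
have <- : fund_class (\sum_(p <- s) tens p.1 p.2) =
    \sum_(phi in B) c phi *: Theta (F_basis k phi).
  rewrite /fund_class raddf_sum big_map big_enum /=; apply: eq_bigr => phi _.
  by rewrite Theta_basis -tensZ linearZ.
move=> s0.
have /mod_piP : fund_class (\sum_(p <- s) tens p.1 p.2) = fund_class 0 :> fund_fun k E X.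
  by rewrite s0 /fund_class raddf0.
rewrite subr0 => /(@J_fun_sum _ _ _ _ _ (lin_corr k Q)).
rewrite big_map big_enum /= => /ffunP /(_ 1%g).
rewrite sum_ffunE ffunE => s1; rewrite -[RHS]s1; apply: eq_bigr => phi _.
by rewrite lin_compZr lin_comp_corr scale_fund_gen.
Qed.

End Rows.

(** * Elimination along the chains and triangularity *)

Section Separation.
Local Open Scope order_scope.
Context {d : Order.disp_t} {T : finTBLatticeType d} {X : finType}.
Implicit Types (S : {set T}) (phi psi : {ffun X -> T}).

(* [S] is the part of the chains already treated; an element of G-hat tests only
   against the elements of [S] on its own chain. *)
Definition cell S (g h : T) : bool :=
  if g \in G_hat T then (h <= hat_top g) && ~~ ((h \in S) && (lat_r_inf h == g))
  else if g \in S then h == g else h <= g.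

Definition sep_row S psi phi : bool :=
  [forall x, cell S (psi x) (phi x)] &&
  [forall e in irr T :\: S, exists x, (psi x == e) && (phi x == e)].

Lemma G_setP g : g \in G_set T -> g \notin G_hat T -> g \in meets_irr T.
Proof. by rewrite inE => /orP[//|->]. Qed.

Definition row_corr psi : corr (irr_type T)^d X :=
  [set p : irr_type T * X | if psi p.2 \in G_hat T
     then hat_top (psi p.2) < val p.1 else psi p.2 <= val p.1].

Lemma admissible_row psi phi : (forall x, psi x \in G_set T) ->
  admissible (corr_comp (row_corr psi) (Gamma phi)) 1 1 = sep_row set0 psi phi.
Proof.
move=> psiG.
have memP (a b : irr_type T) : reflect
    (exists2 x, (a, x) \in row_corr psi & val b <= phi x)
    ((a, b) \in corr_comp (row_corr psi) (Gamma phi)).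
  apply: (iffP (corr_compP _ _ _ _)) => -[x ax xb]; exists x => //.
    by move: xb; rewrite inE.
  by rewrite inE.
apply/admissibleP/andP => [[wit bnd]|[/forallP bnd /forall_inP wit]].
  (* Admissibility bounds only the irreducibles below [phi x]; [le_irr] passes to [phi x] itself. *)
  have {}bnd a x : (a, x) \in row_corr psi -> phi x <= val a.
    move=> ax; apply: le_irr => e eI ex.
    have := bnd a (exist _ e eI); rewrite perm1 invg1 !perm1 leEdual leEsub /=.
    by apply; apply/memP; exists x.
  have bnd' x : cell set0 (psi x) (phi x).
    rewrite /cell !in_set0 /=; case: ifPn => psi_hat.
      (* As [lat_sigma] fixes [hat_top], the bounds by the irreducibles strictly above it combine
         into the bound by [hat_top]. *)
      have [_ _ <-] := hat_topP _ psi_hat; rewrite andbT.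
      apply/meetsP => e /andP[eI te].
      by apply: (bnd (exist _ e eI)); rewrite inE /= psi_hat.
    apply: le_meets_irr; first exact: G_setP.
    by move=> e eI te; apply: (bnd (exist _ e eI)); rewrite inE /= (negPf psi_hat).
  split; first exact/forallP.
  apply/forall_inP => e; rewrite in_setD in_set0 /= => eI.
  have := wit (exist _ e eI); rewrite perm1 => /memP[x ax /= ex].
  have phixE : phi x = e by apply: le_anti; rewrite ex (bnd _ _ ax).
  apply/existsP; exists x; rewrite phixE eqxx andbT.
  (* A value of [psi] in G-hat would put [e] both strictly above [hat_top] and at most [hat_top]. *)
  move: ax (bnd' x); rewrite inE /cell !in_set0 /= phixE.
  case: ifP => _; last by move=> pe ep; rewrite eq_le pe.
  by move=> /lt_geF ->.
split=> [[e eI]|[a aI] [b bI]]; rewrite !perm1.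
  have /existsP[x /andP[/eqP psix /eqP phix]] : [exists x, (psi x == e) && (phi x == e)].
    by apply: wit; rewrite in_setD in_set0.
  apply/memP; exists x; rewrite ?phix //= inE /= psix.
  by rewrite ifN //; apply: contraL eI; exact: G_hat_irrN.
move=> /memP[x ax /= bx]; rewrite invg1 !perm1 leEdual leEsub /=.
apply: le_trans bx _; move: ax (bnd x); rewrite inE /cell !in_set0 /=.
case: ifP => _; last by move=> pa pp; exact: le_trans pp pa.
by rewrite andbT => pa pp; exact: le_trans pp (ltW pa).
Qed.

Context {k : comPzRingType} (B : {set {ffun X -> T}}) (c : {ffun X -> T} -> k).

Definition killed (f : {ffun X -> T} -> bool) : Prop :=
  (\sum_(phi in B) c phi *+ f phi = 0)%R.

Lemma eq_killed f g : f =1 g -> killed f -> killed g.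
Proof. by move=> fg; rewrite /killed; under eq_bigr do rewrite fg. Qed.

Lemma killedD (f g h : {ffun X -> T} -> bool) : killed f -> killed g ->
  (forall phi, f phi = (g phi + h phi)%N :> nat) -> killed h.
Proof.
rewrite /killed => f0 g0 fgh.
rewrite -[LHS]add0r -{1}g0 -big_split -[RHS]f0; apply: eq_bigr => phi _ /=.
by rewrite -mulrnDr fgh.
Qed.

(* Inclusion-exclusion: nonemptiness of [V] is essential, since nothing is known
   about [D] alone. *)
Lemma killed_exact (D : {ffun X -> T} -> bool) (beta : {ffun X -> T} -> {set X})
    (P : {set X}) :
  (forall A : {set X}, A \subset P -> killed (fun phi => D phi && (beta phi :&: A != set0))) ->
  forall V U : {set X}, V \subset P -> U \subset P -> V != set0 ->
  killed (fun phi => [&& D phi, V \subset beta phi & beta phi :&: U == set0]).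
Proof.
move=> DA V; have [n] := ubnP #|V|; elim: n V => // n IH V Vn U VP UP V0.
have /set0Pn[y yV] := V0.
have yP : y \in P by exact: (subsetP VP).
have yUP : y |: U \subset P by rewrite subUset sub1set yP.
have VE : V = y |: (V :\ y) by rewrite setD1K.
have VsubE (A : {set X}) : (V \subset A) = (y \in A) && (V :\ y \subset A).
  by rewrite -sub1set -subUset -VE.
have UE (A : {set X}) : (A :&: (y |: U) == set0) = (y \notin A) && (A :&: U == set0).
  rewrite setIUr setU_eq0; congr andb.
  by rewrite setI_eq0 disjoint_sym disjoints1.
have [Vy0|Vy0] := eqVneq (V :\ y) set0.
  apply: (killedD _ _ _ (DA _ yUP) (DA _ UP)) => phi.
  rewrite UE VsubE Vy0 sub0set.
  by case: (D phi); case: (y \in _); case: (_ == _).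
have VyP : V :\ y \subset P by exact: subset_trans (subsetDl _ _) VP.
have Vyn : (#|V :\ y| < n)%N by move: Vn; rewrite (cardsD1 y) yV.
(* Split the row for [V :\ y] and [U] according to whether [y] lies in [beta phi]. *)
apply: (killedD _ _ _ (IH _ Vyn U VyP UP Vy0) (IH _ Vyn _ VyP yUP Vy0)) => phi.
rewrite UE VsubE.
by case: (D phi); case: (y \in _); case: (_ == _); case: (_ \subset _).
Qed.

(** Induction on the size of [S], deleting a minimal element, which preserves upward closure in the
    chains. Since [psi] attains that element, inclusion-exclusion runs over a nonempty set of
    positions. *)
Lemma killed_sep_row S :
  (forall psi, (forall x, psi x \in G_set T) -> killed (sep_row set0 psi)) ->
  S \subset hat_chain ->
  (forall e h, e \in S -> h \in hat_chain -> e <= h -> h \in S) ->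
  forall psi, (forall x, psi x \in G_set T) -> S \subset [set psi x | x in X] ->
  killed (sep_row S psi).
Proof.
move=> row0; have [n] := ubnP #|S|; elim: n S => // n IH S Sn SC Sup psi psiG Spsi.
have [->|/set0Pn[e0 e0S]] := eqVneq S set0; first exact: row0.
have [e eS emin] : exists2 e, e \in S & forall h, h \in S -> h <= e -> h = e.
  have [m] := ubnP #|[set s | s < e0]|; elim: m e0 e0S => // m IHm e0 e0S mn.
  have [/existsP[h /andP[hS he]]|/existsPn none] :=
    boolP [exists h, (h \in S) && (h < e0)]; last first.
    exists e0 => // h hS; rewrite le_eqVlt => /orP[/eqP //|he].
    by have := none h; rewrite hS he.
  apply: (IHm h) => //; move: mn; rewrite ltnS; apply: leq_trans.
  apply/proper_card/properP; split; last by exists h; rewrite !inE ?ltxx.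
  by apply/subsetP => s; rewrite !inE => /lt_trans; apply.
have eC := subsetP SC _ eS.
have := eC; rewrite inE => /and3P[eI]; set t := lat_r_inf e => tG et.
have te : t <= e by exact: iter_lat_r_le.
have tS f : f \in S -> f <> t.
  by move=> /(subsetP SC); rewrite inE => /andP[fI _] ft;
     have := G_hat_irrN _ tG; rewrite -ft fI.
have eGN : e \notin G_hat T by apply: contraL eI; exact: G_hat_irrN.
(* Inside [P], [psiA A] takes the value [e] on [A] and [t] elsewhere, so [A] becomes the set of
   possible witnesses for [e]. *)
pose P := [set x | (psi x == e) || (psi x == t)].
pose psiA (A : {set X}) : {ffun X -> T} :=
  [ffun x => if x \in P then (if x \in A then e else t) else psi x].
pose S' := S :\ e.
(* On [P] the rows below only differ in which points may witness [e]. *)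
pose D phi := [forall x, if x \in P then phi x <= e else cell S' (psi x) (phi x)] &&
  [forall f in irr T :\: S, exists x, (psi x == f) && (phi x == f)].
pose beta phi := [set x in P | phi x == e].
(* By upward closure, [S'] contains every element of this chain strictly above [e], so only elements
   at most [e] pass the test at [t]. *)
have cellt h : cell S' t h = (h <= e).
  rewrite /cell tG; apply/andP/idP => [[ht hS']|he].
    have [/le_trans -> //|[hC hr]] := le_hat_top _ _ tG ht.
    have /orP[//|eh] := hat_chain_total _ _ hC eC hr.
    move: hS'; rewrite !inE (Sup e h) // hr eqxx !andbT negbK.
    by move=> /eqP ->.
  split; first exact: le_trans he et.
  apply/negP; rewrite !inE => /andP[/andP[/negP hne hS] _].
  by apply: hne; apply/eqP; exact: emin.
have celle h : cell S' e h = (h <= e) by rewrite /cell (negPf eGN) !inE eqxx.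
have DA (A : {set X}) : A \subset P -> killed (fun phi => D phi && (beta phi :&: A != set0)).
  move=> AP; apply: (@eq_killed (sep_row S' (psiA A))); last first.
    apply: IH.
    - by move: Sn; rewrite (cardsD1 e) eS.
    - exact: subset_trans (subsetDl _ _) SC.
    - move=> f h; rewrite !in_setD1 => /andP[fe fS] hC fh; rewrite (Sup f h) // andbT.
      by apply: contra fe => /eqP he; apply/eqP/emin => //; rewrite -he.
    - move=> x; rewrite ffunE; case: ifP => // _; case: ifP => // _; rewrite inE ?tG ?orbT //.
      by rewrite (subsetP irr_meets_irr).
    - apply/subsetP => f; rewrite in_setD1 => /andP[fe fS].
      (* As [f] is neither [e] nor [t], its preimage lies outside [P], where [psiA A] agrees with
         [psi]. *)
      have /imsetP[x _ fx] := subsetP Spsi _ fS.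
      apply/imsetP; exists x => //; rewrite ffunE inE -fx (negPf fe) /=.
      by case: eqP => // /(tS _ fS).
  move=> phi; rewrite /sep_row /D -andbA; congr andb.
    apply: eq_forallb => x; rewrite ffunE; case: ifP => // _.
    by case: ifP => _; rewrite ?celle ?cellt.
  have witE f : f \in irr T -> f != e ->
      [exists x, (psiA A x == f) && (phi x == f)] =
      [exists x, (psi x == f) && (phi x == f)].
    move=> fI fe; apply: eq_existsb => x; rewrite ffunE; case: ifP => // xP.
    have tf : t != f by apply: contraNneq (G_hat_irrN _ tG) => ->.
    have -> : (psi x == f) = false.
      by move: xP; rewrite inE => /orP[] /eqP ->; [rewrite eq_sym|]; apply/negbTE.
    by case: ifP => _; [rewrite eq_sym (negPf fe)|rewrite (negPf tf)].
  have wite : [exists x, (psiA A x == e) && (phi x == e)] = (beta phi :&: A != set0).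
    apply/existsP/set0Pn => -[x].
      rewrite ffunE => /andP[+ xe]; case: ifP => xP; last first.
        by move=> pe; move: xP; rewrite inE pe.
      case: ifP => xA; first by move=> _; exists x; rewrite in_setI xA inE xP xe.
      by move=> /eqP te'; move: (G_hat_irrN _ tG); rewrite te' eI.
    rewrite !inE -andbA => /and3P[xP xe xA]; exists x.
    by rewrite ffunE inE xP xA eqxx xe.
  rewrite -wite; apply/forall_inP/andP => [wit|[/forall_inP wit wit_e] f].
    split; last by apply: wit; rewrite !in_setD in_set1 eqxx.
    apply/forall_inP => f; rewrite in_setD => /andP[fS fI].
    have fe : f != e by apply: contraNneq fS => ->.
    by rewrite -witE // wit // !in_setD fI (negPf fS) andbF.
  rewrite !in_setD in_set1; have [-> //|fe] := eqVneq f e.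
  by move=> /andP[fS fI]; rewrite witE // wit // in_setD fI andbT; exact: fS.
have C0 : [set x | psi x == e] != set0.
  have /imsetP[x _ ex] := subsetP Spsi _ eS.
  by apply/set0Pn; exists x; rewrite inE -ex.
have cellS g h : cell S g h =
    [&& (if (g == e) || (g == t) then h <= e else cell S' g h),
        (g == e) ==> (h == e) & (g == t) ==> (h != e)].
  have net : e == t = false by apply/eqP; exact: tS.
  have [->|ge] := eqVneq g e.
    by rewrite net /= andbT /cell (negPf eGN) eS; case: eqP => [->|]; rewrite ?lexx ?andbF.
  have [->|gt] := eqVneq g t.
    rewrite /= -cellt /cell tG -andbA -negb_or in_setD1; congr (_ && ~~ _).
    by have [->|_] := eqVneq h e; rewrite ?eS ?eqxx // orbF.
  (* For any other [g], deleting [e] from [S] changes nothing: [e] is excluded only by the end point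
     [t] of its own chain. *)
  rewrite /= andbT /cell !in_setD1 ge /=.
  have [->|//] := eqVneq h e; rewrite -/t.
  by rewrite (eq_sym t) (negPf gt) !andbF.
apply: eq_killed (killed_exact _ _ _ DA _ [set x | psi x == t] _ _ C0) => [phi||].
- rewrite /sep_row /D andbAC; congr andb; apply/and3P/forallP.
    move=> [/forallP cellx /subsetP Vb /eqP bU] x; rewrite cellS.
    have := cellx x; rewrite [x \in P]inE => -> /=; apply/andP; split.
      by apply/implyP => xe; have := Vb x; rewrite !inE xe => /(_ isT).
    apply/implyP => xt; apply/negP => xe; have := in_set0 x.
    by rewrite -bU !inE xt xe orbT.
  move=> cellx; split.
  - by apply/forallP => x; have := cellx x; rewrite cellS inE => /andP[].
  - apply/subsetP => x; have := cellx x; rewrite cellS !inE => /and3P[_ xe _] pe.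
    by rewrite pe (implyP xe).
  apply/eqP/setP => x; rewrite !inE; apply/negP => /andP[/andP[_ xe] xt].
  by have := cellx x; rewrite cellS xt xe /= !andbF.
- by apply/subsetP => x; rewrite !inE => ->.
- by apply/subsetP => x; rewrite !inE => ->; rewrite orbT.
Qed.

(** Induction on the number of maps pointwise below [phi]: the row of [phi] has entry 1 at [phi],
    and its other nonzero entries are at smaller maps. *)
Lemma killed_eq0 :
  (forall psi, (forall x, psi x \in G_set T) -> killed (sep_row set0 psi)) ->
  B \subset B_set T X -> forall phi, phi \in B -> c phi = 0%R.
Proof.
move=> row0 /subsetP BE phi.
pose below phi := [set psi : {ffun X -> T} | [forall x, psi x <= phi x]].
have [n] := ubnP #|below phi|; elim: n phi => // n IH phi phin phiB.
have := BE phi phiB; rewrite inE => /andP[/subsetP Ephi /subsetP phiG].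
have {}phiG x : phi x \in G_set T by apply: phiG; exact: imset_f.
have chainI : hat_chain \subset irr T.
  by apply/subsetP => e; rewrite inE => /andP[].
have : killed (sep_row hat_chain phi).
  by apply: killed_sep_row => //; apply/subsetP => e /(subsetP chainI) /Ephi.
have chain_hat g : g \in hat_chain -> g \notin G_hat T.
  by move=> /(subsetP chainI); apply: contraL; exact: G_hat_irrN.
have phi_diag : sep_row hat_chain phi phi.
  apply/andP; split.
    apply/forallP => x; rewrite /cell; case: ifPn => [xG|_]; last by case: ifP.
    rewrite (negPf (contraL (chain_hat _) xG)) andbT.
    by have [_ rt _] := hat_topP _ xG; rewrite -{1}rt; exact: iter_lat_r_le.
  apply/forall_inP => e; rewrite inE => /andP[_ /Ephi /imsetP[x _ ->]].
  by apply/existsP; exists x; rewrite eqxx.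
rewrite /killed (bigD1 phi) //= phi_diag big1 ?addr0 // => psi /andP[psiB psiphi].
have [/andP[/forallP psi_cell _]|_] := boolP (sep_row _ _ _); last by [].
(* A value at most [hat_top] but not below the point of G-hat would lie on its chain, which the test
   now excludes entirely. *)
have {psi_cell}psi_le x : psi x <= phi x.
  have := psi_cell x; rewrite /cell; case: ifPn => [xG /andP[le_top nC]|_].
    have [//|[hC hr]] := le_hat_top _ _ xG le_top.
    by rewrite hC hr eqxx in nC.
  by case: ifP => // _ /eqP ->.
rewrite (IH psi) ?mul0rn //; move: phin; rewrite ltnS; apply: leq_trans.
apply/proper_card/properP; split.
  apply/subsetP => z; rewrite !inE => /forallP zpsi; apply/forallP => x.
  exact: le_trans (zpsi x) (psi_le x).
exists phi; rewrite !inE; first by apply/forallP.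
apply: contra psiphi => /forallP phi_le; apply/eqP/ffunP => x.
by apply: le_anti; rewrite psi_le phi_le.
Qed.

End Separation.

Theorem theorem5p1 (k : comPzRingType) (d : Order.disp_t) (T : finTBLatticeType d)
    (X : finType) (c : {ffun X -> T} -> k) :
  \sum_(phi in B_set T X) c phi *: Theta (F_basis k phi) = 0 ->
  forall phi : {ffun X -> T}, phi \in B_set T X -> c phi = 0.
Proof.
move=> c0; apply: killed_eq0 => // psi psiG.
have := Theta_row _ c (row_corr psi) c0; apply: eq_killed => phi.
exact: admissible_row.
Qed.
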